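(* For every $j\in\{1,\dots,D\}$, $$ r_{n,j}=\frac{D^{s-1}(3Dn+1)!}{n!^{3D}}\sum_{m=1}^D\xi^{-mj}r_{n,m}^*, $$ where $$ r_{n,m}^* =\xi^m\int\!\cdots\!\int\limits_{[0,1]^{s+1}} \frac{\prod_{i=0}^sx_i^{Dn}(1-x_i^D)^n\,\d x_i}{(1-\xi^mx_0\dotsb x_s)^{3Dn+2}} =\int_0^{\xi^m}\!\!\int\!\cdots\!\int\limits_{[0,1]^s} \frac{\prod_{i=0}^sx_i^{Dn}(1-x_i^D)^n\,\d x_i}{(1-x_0\dotsb x_s)^{3Dn+2}} $$ and $\xi=\xi_D$ denotes a primitive root of unity of degree $D$.
   Context: Let $s$ and $D$ be positive integers with $s\ge 3D-1$, and let $n$ be a positive even integer. Let $\zeta(s,\alpha)=\sum_{k=0}^\infty (k+\alpha)^{-s}$ denote the Hurwitz zeta function. For $j\in\{1,\dots,D\}$ define $$ r_{n,j} = \sum_{m=1}^\infty R_n\bigg(m+\frac{j}{D}\bigg), \qquad\text{where}\quad R_n(t) = D^{3Dn} n!^{s+1-3D} \, \frac{ \prod_{l=0}^{3Dn} (t-n+l/D)}{ \prod_{l=0}^n (t+l)^{s+1}}. $$ These are linear forms $r_{n,j}=a_{0,j}+\sum_{2\le i\le s,\ i\equiv s \ (\mathrm{mod}\ 2)} a_i\,\zeta(i,j/D)$ with rational coefficients. *)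

(* Defs.v *)
From HB Require Import structures.
From mathcomp Require Import all_boot all_order all_algebra.
From mathcomp Require Import all_classical all_reals all_analysis.
From mathcomp Require Import complex.
Set Implicit Arguments. Unset Strict Implicit. Unset Printing Implicit Defensive.
Import Order.TTheory GRing.Theory Num.Theory.
Local Open Scope ring_scope.
Local Open Scope classical_set_scope.
Local Open Scope complex_scope.

Definition Rn (R : realType) (s D n : nat) (t : R) : R :=
  (D%:R ^+ (3 * D * n)) * (n`!%:R ^+ (s.+1 - 3 * D)%N)
  * (\prod_(0 <= l < (3 * D * n).+1) (t - n%:R + l%:R / D%:R))
  / (\prod_(0 <= l < n.+1) (t + l%:R) ^+ s.+1).

Definition rnj (R : realType) (s D n j : nat) : R :=
  (\big[+%R/0%R]_(1 <= m <oo) Rn s D n (m%:R + j%:R / D%:R)).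

Fixpoint iter_int (R : realType) (k : nat) (f : seq R -> R) : R :=
  if k is k'.+1 then
    \int[@lebesgue_measure R]_(x in `[0%R, 1%R]) iter_int k' (fun v => f (x :: v))
  else f [::].

Definition citer_int (R : realType) (k : nat) (f : seq R -> R[i]) : R[i] :=
  Complex (iter_int k (fun v => complex.Re (f v))) (iter_int k (fun v => complex.Im (f v))).

Definition rstar_integrand (R : realType) (D n m : nat) (xi : R[i]) (v : seq R) : R[i] :=
  (\prod_(x <- v) (x ^+ (D * n) * (1 - x ^+ D) ^+ n))%:C
  / (1 - xi ^+ m * (\prod_(x <- v) x)%:C) ^+ (3 * D * n + 2).

Definition rstar (R : realType) (s D n m : nat) (xi : R[i]) : R[i] :=
  xi ^+ m * citer_int s.+1 (rstar_integrand D n m xi).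

(* Main.v *)
(** Expand [(1 - z)^-(N+1) = \sum_k 'C(k + N, N) z^k] with [N = 3Dn+1] and
    [z = xi^m x_0 ... x_s] in the integrand of [rstar] and integrate term by
    term: with [I_k = moment R D n k], the integral of [x^(Dn+k) (1 - x^D)^n]
    over [0, 1],
    [rstar = xi^m \sum_k 'C(k + N, N) xi^(mk) I_k^(s+1)].  Averaging over the
    powers of [xi] keeps the [k] with [k + 1 = j] modulo [D].  Since
    [I_k = D^n n! / \prod_(l <= n) (Dn + k + 1 + lD)], the term [k = qD + j - 1]
    is, up to the common constant, [R_n(q + n + j/D)], and the terms
    [R_n(m + j/D)] with [m < n] vanish.

    Limits in [R[i]] are taken coordinatewise, so that only real analysis is
    needed. *)
Require Import Defs.
From HB Require Import structures.
From mathcomp Require Import all_boot all_order all_algebra.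
From mathcomp Require Import all_classical all_reals all_analysis.
From mathcomp Require Import complex.
From mathcomp Require Import measurable_realfun.
From mathcomp Require Import ring lra zify.
Set Implicit Arguments. Unset Strict Implicit. Unset Printing Implicit Defensive.
Import Order.TTheory GRing.Theory Num.Theory.
Import numFieldNormedType.Exports.
Local Open Scope classical_set_scope.
Local Open Scope ring_scope.
Local Open Scope complex_scope.

Local Notation Re := complex.Re.
Local Notation Im := complex.Im.
Local Notation normc := (@ComplexField.Normc.normc _).

(** * Termwise integration of series, over one variable and then over the cube *)

Lemma nneseries_EFin (R : realType) (u : R^nat) :
  cvgn (series u) -> (\sum_(k <oo) (u k)%:E)%E = (limn (series u))%:E.
Proof.
move=> cu; apply/cvg_lim => //; apply/fine_cvgP; split.
  by apply: nearW => n; rewrite sumEFin.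
by apply: cvg_trans cu; apply: near_eq_cvg; apply: nearW => n /=;
  rewrite sumEFin seriesEnat.
Qed.

(** Dominated convergence for the partial sums, with the series of absolute values as dominating
    function; the latter is integrable because nonnegative series may be integrated termwise. *)
Lemma Rintegral_series (R : realType) d (T : measurableType d)
    (mu : {measure set T -> \bar R}) (D : set T) (a : nat -> T -> R) :
  measurable D ->
  (forall k, mu.-integrable D (EFin \o a k)) ->
  (forall x, D x -> cvgn (series (fun k => `|a k x|))) ->
  cvgn (series (fun k => Rintegral mu D (fun x => `|a k x|))) ->
  series (fun k => Rintegral mu D (a k)) @ \oo -->
    Rintegral mu D (fun x => limn (series (a ^~ x))).
Proof.
move=> mD ia cx ci.
have ma k : measurable_fun D (a k).
  by apply/measurable_EFinP; case/integrableP: (ia k).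
have sE x n : series (a ^~ x) n = \sum_(0 <= k < n) a k x by rewrite seriesEnat.
pose f_ n x := (series (a ^~ x) n)%:E.
pose f x := (limn (series (a ^~ x)))%:E.
pose g x := (\sum_(k <oo) `|a k x|%:E)%E.
have cax x : D x -> series (a ^~ x) @ \oo --> limn (series (a ^~ x)).
  by move=> Dx; exact: (@normed_cvg R R^o _ (cx _ Dx)).
have mf_ n : measurable_fun D (f_ n).
  by apply/measurable_EFinP; apply: measurable_sum => k.
have f_f x : D x -> f_ ^~ x @ \oo --> f x.
  by move=> Dx; apply/fine_cvgP; split; [exact: nearW|exact: cax].
have mf : measurable_fun D f.
  apply/measurable_EFinP.
  apply: (@measurable_fun_cvg _ _ _ _ (fun n x => series (a ^~ x) n)).
  - by move=> n; apply: measurable_sum => k.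
  - exact: cax.
have iabs k : (\int[mu]_(x in D) `|a k x|%:E = (Rintegral mu D (fun x => `|a k x|))%:E)%E.
  rewrite /Rintegral fineK//; apply: integrable_fin_num => //.
  exact: (integrable_abse (ia k)).
have ig : mu.-integrable D g.
  apply/integrableP; split.
    apply: ge0_emeasurable_sum => // k _; apply/measurable_EFinP.
    exact: measurableT_comp.
  under eq_integral.
    move=> x xD; rewrite gee0_abs; last by apply: nneseries_ge0.
    over.
  rewrite integral_nneseries//; last first.
    by move=> k; apply/measurable_EFinP; exact: measurableT_comp.
  under eq_eseriesr do rewrite iabs.
  by rewrite nneseries_EFin ?ltry.
have f_g x n : D x -> (`|f_ n x| <= g x)%E.
  move=> Dx; rewrite /f_ /=; apply: (@le_trans _ _ (\sum_(0 <= k < n) `|a k x|%:E)%E).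
    by rewrite sumEFin lee_fin sE ler_norm_sum.
  by apply: nneseries_lim_ge => k _ _; rewrite lee_fin.
have [_ _] := dominated_convergence mD mf_ mf
  (aeW _ f_f) ig (aeW _ (fun x n Dx => f_g x n Dx)).
rewrite -(@fineK _ (\int[mu]_(x in D) f x)%E); last first.
  apply: integrable_fin_num => //.
  by have [] := dominated_convergence mD mf_ mf
    (aeW _ f_f) ig (aeW _ (fun x n Dx => f_g x n Dx)).
move=> /fine_cvg fI; suff -> : series (fun k => Rintegral mu D (a k)) =
  fine \o (fun n => (\int[mu]_(x in D) f_ n x)%E) by exact: fI.
apply/funext => n /=.
rewrite /f_; under eq_integral do rewrite sE -sumEFin.
rewrite integral_sum//=.
rewrite (eq_bigr (fun k => (Rintegral mu D (a k))%:E)) ?sumEFin ?seriesEnat//.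
by move=> k _; rewrite /Rintegral fineK//; apply: integrable_fin_num => //; exact: ia.
Qed.

Lemma eq_iter_int (R : realType) (k : nat) (f g : seq R -> R) :
  (forall v, size v = k -> all (fun x => 0 <= x <= 1) v -> f v = g v) ->
  iter_int k f = iter_int k g.
Proof.
elim: k f g => [|k IH] f g fg /=; first exact: fg.
apply: eq_Rintegral => x; rewrite inE/= in_itv/= => x01.
by apply: IH => v vk v01; apply: fg; rewrite /= ?vk ?x01.
Qed.

(** Induction on [p]: the outermost variable [x] is absorbed into the coefficients, which become
    [c k * w k x]; hence the generality in [c]. As [0 <= w k x <= 1], the summability hypotheses
    pass to the new coefficients. *)
Lemma iter_int_series (R : realType) (w : nat -> R -> R) (p : nat) :
  let I k := \int[@lebesgue_measure R]_(x in `[0, 1]) w k x in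
  (forall k, (@lebesgue_measure R).-integrable `[0%R, 1%R]%classic (EFin \o w k)) ->
  (forall k x, 0 <= x <= 1 -> 0 <= w k x <= 1) ->
  forall c : nat -> R,
  (forall x, 0 <= x <= 1 -> cvgn (series (fun k => `|c k| * w k x))) ->
  cvgn (series (fun k => `|c k| * I k ^+ p)) ->
  iter_int p (fun v => limn (series (fun k => c k * \prod_(x <- v) w k x))) =
  limn (series (fun k => c k * I k ^+ p)).
Proof.
move=> I iw w01.
have I0 k : 0 <= I k.
  by apply: Rintegral_ge0 => x /=; rewrite in_itv/= => /(w01 k)/andP[].
have I1 k : I k <= 1.
  have <- : \int[@lebesgue_measure R]_(x in `[0%R, 1%R]%classic) (cst 1 x) = 1.
    by rewrite Rintegral_cst//= lebesgue_measure_itv/= lte_fin ltr01 oppr0 adde0 mul1r.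
  apply: le_Rintegral => //.
    apply: (@continuous_compact_integrable R (cst 1)); first exact: segment_compact.
    by move=> x; exact: cvg_cst.
  by move=> x /=; rewrite in_itv/= => /(w01 k)/andP[].
elim: p => [|p IH] c cw cI.
  by rewrite /=; under eq_fun do rewrite big_nil.
rewrite /=.
transitivity (\int[@lebesgue_measure R]_(x in `[0, 1])
  limn (series (fun k => c k * w k x * I k ^+ p))).
  apply: eq_Rintegral => x; rewrite inE/= in_itv/= => x01.
  rewrite -IH.
  - by congr iter_int; apply/funext => v; under eq_fun do rewrite big_cons mulrA.
  - move=> y y01; apply: (series_le_cvg _ _ _ (cw _ x01)) => k.
    + by case/andP: (w01 k _ y01) => *; rewrite mulr_ge0.
    + by case/andP: (w01 k _ x01) => *; rewrite mulr_ge0.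
    + case/andP: (w01 k _ y01) (w01 k _ x01) => y0 y1 /andP[x0 x1].
      by rewrite normrM (ger0_norm x0) ler_piMr// mulr_ge0.
  - apply: (series_le_cvg _ _ _ (cw _ x01)) => k.
    + by rewrite mulr_ge0// exprn_ge0.
    + by case/andP: (w01 k _ x01) => *; rewrite mulr_ge0.
    + case/andP: (w01 k _ x01) => x0 x1.
      by rewrite normrM (ger0_norm x0) ler_piMr ?mulr_ge0// exprn_ile1.
have intE k b : \int[@lebesgue_measure R]_(x in `[0, 1]) (b * w k x * I k ^+ p)
   = b * I k ^+ p.+1.
  under eq_Rintegral do rewrite mulrAC.
  by rewrite RintegralZl// exprS mulrA mulrAC.
apply/esym/cvg_lim => //.
rewrite (_ : (fun k => c k * _) = (fun k =>
    \int[@lebesgue_measure R]_(x in `[0, 1]) (c k * w k x * I k ^+ p))); last first.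
  by apply/funext => k; rewrite intE.
have normE k x : 0 <= x <= 1 -> `|c k * w k x * I k ^+ p| = `|c k| * w k x * I k ^+ p.
  by move=> /(w01 k)/andP[x0 _]; rewrite !normrM normrX (ger0_norm x0) (ger0_norm (I0 k)).
apply: Rintegral_series => //.
- move=> k.
  rewrite (_ : EFin \o _ = (fun x => (c k * I k ^+ p)%:E * (EFin \o w k) x)%E).
    exact: integrableZl.
  by apply/funext => x /=; rewrite -EFinM mulrAC.
- move=> x /=; rewrite in_itv/= => x01.
  rewrite (_ : (fun k => _) = (fun k => `|c k| * w k x * I k ^+ p)); last first.
    by apply/funext => k; rewrite normE.
  apply: (series_le_cvg _ _ _ (cw _ x01)) => k.
  + by case/andP: (w01 k _ x01) => *; rewrite mulr_ge0 ?mulr_ge0// exprn_ge0.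
  + by case/andP: (w01 k _ x01) => *; rewrite mulr_ge0.
  + case/andP: (w01 k _ x01) => x0 x1.
    by rewrite ler_piMr ?mulr_ge0// exprn_ile1.
- rewrite (_ : (fun k => _) = (fun k => `|c k| * I k ^+ p.+1))//.
  apply/funext => k; rewrite -intE; apply: eq_Rintegral => x.
  by rewrite inE/= in_itv/= => x01; rewrite normE.
Qed.

(** * Negative binomial series over the reals *)

(** Pascal's rule: the factor [1 - z] lowers the order by one, up to a boundary term. The real bound
    and the complex limit below both rest on it, by induction on [N]. *)
Lemma bin_sum_geometric (A : comNzRingType) (z : A) N K :
  (1 - z) * (\sum_(0 <= k < K) 'C(k + N.+1, N.+1)%:R * z ^+ k) =
  \sum_(0 <= k < K) 'C(k + N, N)%:R * z ^+ k - 'C(K + N, N.+1)%:R * z ^+ K.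
Proof.
elim: K => [|K IH].
  by rewrite !big_geq// bin_small// mul0r subr0 mulr0.
rewrite !big_nat_recr//= mulrDr IH addnS addSn binS natrD exprS.
ring.
Qed.

Lemma bin0_sum_geometric (A : comNzRingType) (z : A) K :
  (1 - z) * (\sum_(0 <= k < K) 'C(k + 0, 0)%:R * z ^+ k) = 1 - z ^+ K.
Proof.
elim: K => [|K IH]; first by rewrite big_geq// mulr0 expr0 subrr.
by rewrite big_nat_recr//= mulrDr IH bin0 mul1r exprS; ring.
Qed.

(** Each induction step divides by [1 - r]; the subtracted boundary term is nonnegative and is
    dropped. *)
Lemma bin_sum_le (R : realType) (r : R) N K : 0 <= r < 1 ->
  \sum_(0 <= k < K) 'C(k + N, N)%:R * r ^+ k <= (1 - r) ^- N.+1.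
Proof.
move=> /andP[r0 r1]; have r1' : 0 < 1 - r by rewrite subr_gt0.
elim: N => [|N IH].
  by rewrite expr1 -[leRHS]mul1r ler_pdivlMr// mulrC bin0_sum_geometric lerBlDr lerDl exprn_ge0.
rewrite exprSr invfM ler_pdivlMr// mulrC bin_sum_geometric.
apply: le_trans IH; rewrite lerBlDr lerDl.
by rewrite mulr_ge0// exprn_ge0.
Qed.

Lemma is_cvg_bin_series (R : realType) (r : R) N : 0 <= r < 1 ->
  cvgn (series (fun k => 'C(k + N, N)%:R * r ^+ k)).
Proof.
move=> r01; apply: nondecreasing_is_cvgn.
  apply: nondecreasing_series => k _ _.
  by case/andP: r01 => *; rewrite mulr_ge0// exprn_ge0.
by exists ((1 - r) ^- N.+1) => _ [K _ <-]; rewrite seriesEnat/= bin_sum_le.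
Qed.


(** * Coordinatewise limits in [R[i]] and the complex binomial series *)

Definition ccvg (R : realType) (u : nat -> R[i]) (l : R[i]) : Prop :=
  (fun n => Re (u n)) @ \oo --> Re l /\ (fun n => Im (u n)) @ \oo --> Im l.

Lemma ccvg_real (R : realType) (u : nat -> R) (l : R) :
  u @ \oo --> l -> ccvg (fun n => (u n)%:C) l%:C.
Proof. by move=> ul; split => //=; exact: cvg_cst. Qed.

Lemma ccvg_unique (R : realType) (u : nat -> R[i]) (l l' : R[i]) :
  ccvg u l -> ccvg u l' -> l = l'.
Proof.
case: l l' => [a b] [a' b'] [/= ua ub] [/= ua' ub'].
by congr Complex; [apply: (cvg_unique _ ua ua')|apply: (cvg_unique _ ub ub')].
Qed.

Lemma ccvg_comp (R : realType) (u : nat -> R[i]) (l : R[i]) (f : nat -> nat) :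
  f n @[n --> \oo] --> \oo -> ccvg u l -> ccvg (u \o f) l.
Proof.
move=> fo [ua ub]; split.
- exact: (cvg_comp _ _ fo ua).
- exact: (cvg_comp _ _ fo ub).
Qed.

Lemma ccvgMl (R : realType) (a : R[i]) (u : nat -> R[i]) (l : R[i]) :
  ccvg u l -> ccvg (fun n => a * u n) (a * l).
Proof.
case=> ur ui; split.
- rewrite (_ : (fun n => _) = (fun n => Re a * Re (u n) - Im a * Im (u n))).
    rewrite (_ : Re (a * l) = Re a * Re l - Im a * Im l).
      by apply: cvgB; apply: cvgMl_tmp.
    by case: a l {ur ui} => [? ?] [].
  by apply/funext => n; case: a (u n) => [? ?] [].
- rewrite (_ : (fun n => _) = (fun n => Re a * Im (u n) + Im a * Re (u n))).
    rewrite (_ : Im (a * l) = Re a * Im l + Im a * Re l).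
      by apply: cvgD; apply: cvgMl_tmp.
    by case: a l {ur ui} => [? ?] [].
  by apply/funext => n; case: a (u n) => [? ?] [].
Qed.

Lemma ccvgD (R : realType) (u v : nat -> R[i]) (l l' : R[i]) :
  ccvg u l -> ccvg v l' -> ccvg (fun n => u n + v n) (l + l').
Proof.
case=> ur ui [vr vi]; split.
- rewrite raddfD; under eq_fun do rewrite raddfD; exact: cvgD.
- rewrite raddfD; under eq_fun do rewrite raddfD; exact: cvgD.
Qed.

Lemma ccvg_sum (R : realType) (I : Type) (r : seq I)
    (u : I -> nat -> R[i]) (l : I -> R[i]) :
  (forall i, ccvg (u i) (l i)) -> ccvg (fun n => \sum_(i <- r) u i n) (\sum_(i <- r) l i).
Proof.
move=> ul; elim: r => [|i r IH].
  by rewrite big_nil; under eq_fun do rewrite big_nil; split; exact: cvg_cst.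
by rewrite big_cons; under eq_fun do rewrite big_cons; exact: ccvgD.
Qed.

Lemma normr_Re_le (R : realType) (z : R[i]) : `|Re z| <= normc z.
Proof.
by case: z => a b /=; rewrite -sqrtr_sqr ler_sqrt ?lerDl ?addr_ge0 ?sqr_ge0.
Qed.

Lemma normr_Im_le (R : realType) (z : R[i]) : `|Im z| <= normc z.
Proof.
by case: z => a b /=; rewrite -sqrtr_sqr ler_sqrt ?lerDr ?addr_ge0 ?sqr_ge0.
Qed.

Lemma ccvg0_normc (R : realType) (u : nat -> R[i]) :
  (fun n => normc (u n)) @ \oo --> (0 : R) -> ccvg u 0.
Proof.
move=> u0.
split; apply/norm_cvg0P; apply: (squeeze_cvgr _ (cvg_cst 0) u0); apply: nearW => n;
  by rewrite normr_ge0/= ?normr_Re_le ?normr_Im_le.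
Qed.

Lemma normcX (R : realType) (z : R[i]) k : normc (z ^+ k) = normc z ^+ k.
Proof.
elim: k => [|k IH]; first by rewrite !expr0 ComplexField.Normc.normc1.
by rewrite !exprS ComplexField.Normc.normcM IH.
Qed.

Lemma normc_real (R : realType) (x : R) : normc x%:C = `|x|.
Proof. by rewrite /= expr0n addr0 sqrtr_sqr. Qed.

Lemma ccvg_bin_series (R : realType) (z : R[i]) N : normc z < 1 ->
  ccvg (fun K => \sum_(0 <= k < K) 'C(k + N, N)%:R * z ^+ k) ((1 - z) ^- N.+1).
Proof.
move=> z1.
have z0 : 1 - z != 0.
  apply: contraTneq z1 => /eqP; rewrite subr_eq0 => /eqP <-.
  by rewrite ComplexField.Normc.normc1 ltxx.
have r01 : 0 <= normc z < 1.
  by rewrite z1 andbT; case: (z) => a b; exact: sqrtr_ge0.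
have normCz m k : normc (m%:R * z ^+ k) = m%:R * normc z ^+ k.
  rewrite ComplexField.Normc.normcM normcX; congr (_ * _).
  by rewrite -(rmorph_nat (real_complex R)) normc_real normr_nat.
(* The boundary term tends to 0: its modulus is at most the [K]-th term of a convergent real series,
   as ['C(K + M, M.+1) <= 'C(K + M.+1, M.+1)]. *)
have C0 M : ccvg (fun K => 'C(K + M, M.+1)%:R * z ^+ K) 0.
  apply: ccvg0_normc; under eq_fun do rewrite normCz.
  have := cvg_series_cvg_0 (@is_cvg_bin_series _ _ M.+1 r01).
  apply: (squeeze_cvgr _ (cvg_cst 0)); apply: nearW => k.
  case/andP: r01 => r0 _; rewrite mulr_ge0 ?exprn_ge0//=.
  by rewrite ler_wpM2r ?exprn_ge0// ler_nat addnS binS leq_addr.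
elim: N => [|N IH].
  (* The limit is written as [(1 - z)^-1 * (1 - 0)], where 0 is the limit of [z ^+ K]. *)
  rewrite expr1 -[(1 - z)^-1]mulr1 -[X in _ * X](subr0 1).
  rewrite (_ : (fun K => _) = (fun K => (1 - z)^-1 * (1 + (-1) * z ^+ K))); last first.
    by apply/funext => K; apply: (mulfI z0); rewrite bin0_sum_geometric mulVKf// mulN1r.
  apply: ccvgMl; apply: ccvgD; first by split; exact: cvg_cst.
  rewrite -[X in ccvg _ X](_ : (-1) * 0 = - 0); last by rewrite mulr0 oppr0.
  apply: ccvgMl; apply: ccvg0_normc; under eq_fun do rewrite normcX.
  by apply: cvg_expr; case/andP: r01 => r0 ?; rewrite ger0_norm.
rewrite exprS invfM -[X in _ * X](subr0).
rewrite (_ : (fun K => _) = (fun K => (1 - z)^-1 *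
  (\sum_(0 <= k < K) 'C(k + N, N)%:R * z ^+ k +
    (-1) * ('C(K + N, N.+1)%:R * z ^+ K)))); last first.
  by apply/funext => K; apply: (mulfI z0); rewrite bin_sum_geometric mulVKf// mulN1r.
apply: ccvgMl; apply: ccvgD => //.
rewrite -[X in ccvg _ X](_ : (-1) * 0 = - 0); last by rewrite mulr0 oppr0.
exact: ccvgMl.
Qed.

(** * Closed form of the one-variable integral *)

Lemma integrable_exprM_1subXn (R : realType) (D a n : nat) :
  (@lebesgue_measure R).-integrable `[0%R, 1%R]%classic
    (EFin \o (fun x => x ^+ a * (1 - x ^+ D) ^+ n)).
Proof.
apply: continuous_compact_integrable; first exact: segment_compact.
apply: continuous_in_subspaceT => x _.
apply: cvgM; first exact: exprn_continuous.
apply: (@cvg_comp _ _ _ (fun x => 1 - x ^+ D) (fun x => x ^+ n)).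
  by apply: cvgB; [exact: cvg_cst|exact: exprn_continuous].
exact: exprn_continuous.
Qed.

(** Induction on [n] from (1 - x^D)^(n+1) = (1 - x^D)^n - x^D (1 - x^D)^n, which leaves two
    integrals with exponents [a] and [a + D]. *)
Lemma Rintegral_exprM_1subXn (R : realType) (D a n : nat) :
  \int[@lebesgue_measure R]_(x in `[0, 1]) (x ^+ a * (1 - x ^+ D) ^+ n) =
  (D ^ n * n`!)%:R / (\prod_(0 <= l < n.+1) (a.+1 + l * D))%:R.
Proof.
elim: n a => [|n IH] a.
  have := @beta_fun_fact R a 0.
  rewrite /beta_fun -Rintegral_mkcond /= fact0 muln1 addn0 => H.
  rewrite big_nat1 mul0n addn0 expn0 mul1n mul1r.
  rewrite -[RHS](_ : a`!%:R / (a.+1)`!%:R = _).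
    by rewrite -H; apply: eq_Rintegral => x _; rewrite XMonemXn0 expr0 mulr1.
  by rewrite factS natrM invfM mulrCA divff ?mulr1// pnatr_eq0 -lt0n fact_gt0.
rewrite -[LHS](_ : \int[@lebesgue_measure R]_(x in `[0, 1])
   (x ^+ a * (1 - x ^+ D) ^+ n - x ^+ (a + D) * (1 - x ^+ D) ^+ n) = _); last first.
  by apply: eq_Rintegral => x _; rewrite exprD exprS; ring.
rewrite RintegralB//; [|exact: integrable_exprM_1subXn|exact: integrable_exprM_1subXn].
rewrite !IH; set P := (\prod_(0 <= l < n.+1) (a.+1 + l * D))%N.
set Q := (\prod_(0 <= l < n.+1) _)%N.
set S := (\prod_(0 <= l < n.+2) _)%N.
(* Without its last factor [S] is [P], without its first it is [Q]; so 1/P - 1/Q = (n+1)D/S. *)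
have SP : S = (P * (a.+1 + n.+1 * D))%N by rewrite /S big_nat_recr.
have SQ : S = (a.+1 * Q)%N.
  rewrite /S big_nat_recl// mul0n addn0; congr muln.
  by apply: eq_bigr => l _; rewrite mulSn; lia.
have S0 : (0 < S)%N by rewrite prodn_gt0.
have [P0 Q0] : (0 < P)%N /\ (0 < Q)%N by split; rewrite prodn_gt0.
have e1 : P%:R^-1 = (a.+1 + n.+1 * D)%:R / S%:R :> R.
  by rewrite SP natrM invfM mulrCA divff ?mulr1// pnatr_eq0.
have e2 : Q%:R^-1 = a.+1%:R / S%:R :> R.
  by rewrite SQ natrM invfM mulrA divff ?mul1r// pnatr_eq0.
rewrite e1 e2 expnS factS !natrM natrD natrM; ring.
Qed.

(** * Binomial estimates and a convergence test *)

(** From (N+1) C(k+N+1, N+1) = (k+N+1) C(k+N, N) and k+N+1 <= (N+1)(k+1). *)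
Lemma bin_le_expn k N : ('C(k + N, N) <= k.+1 ^ N)%N.
Proof.
elim: N => [|N IH]; first by rewrite bin0.
rewrite -(@leq_pmul2l N.+1)// addnS -mul_bin_diag expnS /=.
apply: (@leq_trans ((k + N).+1 * k.+1 ^ N)); first by rewrite leq_mul2l IH orbT.
by rewrite mulnA leq_mul2r; apply/orP; right; nia.
Qed.

(** A rising factorial; it turns the numerator of [Rn] into a binomial coefficient. *)
Lemma prod_addn_bin k N : (\prod_(0 <= l < N) (k.+1 + l) = N`! * 'C(k + N, N))%N.
Proof.
elim: N => [|N IH]; first by rewrite big_geq// bin0.
rewrite big_nat_recr//= IH factS addnS.
by have /= := mul_bin_diag (k + N).+1 N; nia.
Qed.

(** Comparison with a telescoping series: 1/x^2 <= 2 (1/x - 1/(x+1)) for x >= 1, whence the bound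
    [2 * C]. *)
Lemma is_cvg_series_inv_sqr (R : realType) (C : R) (u : nat -> R) :
  (forall k, 0 <= u k <= C / k.+1%:R ^+ 2) -> cvgn (series u).
Proof.
move=> uC; have C0 : 0 <= C.
  by case/andP: (uC 0) => a b; have := le_trans a b; rewrite expr1n divr1.
apply: nondecreasing_is_cvgn.
  by apply: nondecreasing_series => k _ _; case/andP: (uC k).
exists (2 * C) => _ [K _ <-]; rewrite seriesEnat/=.
suff: \sum_(0 <= k < K) u k <= 2 * C * (1 - K.+1%:R^-1).
  by move=> /le_trans; apply; rewrite -[leRHS]mulr1 ler_wpM2l ?mulr_ge0//.
elim: K => [|K IH]; first by rewrite big_geq// invr1 subrr mulr0.
rewrite big_nat_recr//=; apply: (le_trans (lerD IH (proj2 (andP (uC K))))).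
rewrite -[in leRHS](natr1 K.+1).
set x : R := K.+1%:R; have x1 : 1 <= x by rewrite ler1n.
rewrite -subr_ge0.
rewrite (_ : _ - _ = C * (x - 1) / (x ^+ 2 * (x + 1))); last first.
  by field; apply/andP; split; lra.
apply: divr_ge0; first (apply: mulr_ge0 => //; lra).
by apply: mulr_ge0; [exact: sqr_ge0|lra].
Qed.

(** * Root of unity filter *)

(** Each summand is the [m]-th power of w = xi^(k+1-j), so this is a geometric sum over a [D]-th
    root of unity. The shift [k.+1] comes from the prefactor [xi ^+ m] of [rstar]. *)
Lemma prim_root_filter (F : fieldType) (D : nat) (xi : F) (j k : nat) :
  D.-primitive_root xi ->
  \sum_(1 <= m < D.+1) xi ^- (m * j) * (xi ^+ m * xi ^+ m ^+ k) =
  if k.+1 == j %[mod D] then D%:R else 0.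
Proof.
move=> xiP; set w := xi ^+ k.+1 / xi ^+ j.
have xi0 : xi != 0.
  apply/eqP => xi0; have := prim_expr_order xiP.
  by rewrite xi0 expr0n (gtn_eqF (prim_order_gt0 xiP)) => /esym/eqP; rewrite oner_eq0.
transitivity (\sum_(1 <= m < D.+1) w ^+ m).
  apply: eq_bigr => m _; rewrite /w exprMn exprVn -!exprM -exprD mulrC.
  by rewrite [(j * m)%N]mulnC mulSn [(k * m)%N]mulnC.
have w1E : (w == 1) = (k.+1 == j %[mod D]).
  rewrite -(inj_eq (mulIf (expf_neq0 j xi0))) mulfVK ?expf_neq0// mul1r.
  exact: (eq_prim_root_expr xiP).
case: ifP w1E => _ => [/eqP ->|w1].
  under eq_bigr do rewrite expr1n.
  by rewrite big_const_nat subn1 /= iter_addr_0.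
have wD : w ^+ D = 1.
  rewrite /w exprMn exprVn -!exprM ![(_ * D)%N]mulnC !exprM.
  by rewrite (prim_expr_order xiP) !expr1n invr1 mulr1.
rewrite big_add1 /=; under eq_bigr do rewrite exprS.
rewrite -mulr_sumr; apply/eqP; rewrite mulf_eq0; apply/orP; right.
have := subrX1 w D; rewrite wD subrr big_mkord => /esym/eqP.
by rewrite mulf_eq0 subr_eq0 w1.
Qed.

(** * Moments and the expansion of the multiple integral *)

Definition weight (R : realType) (D n k : nat) (x : R) : R :=
  x ^+ (k + D * n) * (1 - x ^+ D) ^+ n.

Definition moment (R : realType) (D n k : nat) : R :=
  \int[@lebesgue_measure R]_(x in `[0, 1]) weight D n k x.

Section Moments.
Variables (R : realType) (D n : nat).
Hypotheses (D0 : (0 < D)%N) (n0 : (0 < n)%N).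

Lemma weight_itv k (x : R) : 0 <= x <= 1 -> 0 <= weight D n k x <= x ^+ k.
Proof.
move=> /andP[x0 x1]; rewrite /weight.
have xD : 0 <= 1 - x ^+ D <= 1.
  by rewrite subr_ge0 exprn_ile1// gerBl exprn_ge0.
case/andP: xD => a b; rewrite mulr_ge0 ?exprn_ge0//= exprD -mulrA.
by rewrite ler_piMr ?exprn_ge0// mulr_ile1 ?exprn_ge0 ?exprn_ile1.
Qed.

Lemma weight_le1 k (x : R) : 0 <= x <= 1 -> 0 <= weight D n k x <= 1.
Proof.
move=> x01; case/andP: (weight_itv k x01) => -> /le_trans; apply.
by case/andP: x01 => x0 x1; rewrite exprn_ile1.
Qed.

Lemma weight1 k : weight D n k (1 : R) = 0.
Proof. by rewrite /weight !expr1n subrr expr0n (gtn_eqF n0) mulr0. Qed.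

Lemma momentE k : moment R D n k =
  (D ^ n * n`!)%:R / (\prod_(0 <= l < n.+1) (k.+1 + D * n + l * D))%:R.
Proof. exact: Rintegral_exprM_1subXn. Qed.

Lemma moment_ge0 k : 0 <= moment R D n k.
Proof. by rewrite momentE divr_ge0. Qed.

Lemma moment_le k : moment R D n k <= (D ^ n * n`!)%:R / k.+1%:R ^+ n.+1.
Proof.
rewrite momentE ler_wpM2l// lef_pV2 ?posrE ?ltr0n ?exprn_gt0// -?natrX ?ler_nat; last first.
  by rewrite prodn_gt0.
rewrite (_ : (k.+1 ^ n.+1)%N = \prod_(0 <= l < n.+1) k.+1).
  by apply: leq_prod => l _; rewrite -addnA leq_addr.
by rewrite prod_nat_const_nat subn0.
Qed.

(** The numerator is the product of the numbers lD with 1 <= l <= n, each at most the matching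
    factor of the denominator. The bound allows the exponent [s.+1] to be lowered to [3 * D]
    below. *)
Lemma moment_le1 k : moment R D n k <= 1.
Proof.
rewrite momentE ler_pdivrMr ?mul1r ?ler_nat ?ltr0n; last by rewrite prodn_gt0.
have -> : (D ^ n * n`! = \prod_(1 <= l < n.+1) (l * D))%N.
  elim: (n) => [|m IH]; first by rewrite big_geq.
  by rewrite big_nat_recr//= -IH factS expnS; lia.
rewrite big_add1 big_nat_recl//= -[leqLHS]mul1n leq_mul//.
  by apply: leq_prod => l _; lia.
Qed.

(** Here [3 * D - 1 <= s] enters: at least 3D moments, each O(k^-(n+1)), against a binomial
    coefficient O(k^(3Dn+1)), leave O(k^(1-3D)), which is O(k^-2). *)
Lemma is_cvg_bin_moment (s : nat) : (3 * D - 1 <= s)%N ->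
  cvgn (series (fun k =>
    'C(k + (3 * D * n).+1, (3 * D * n).+1)%:R * moment R D n k ^+ s.+1)).
Proof.
move=> sD; set N := (3 * D * n).+1.
set M : R := (D ^ n * n`!)%:R ^+ (3 * D).
apply: (is_cvg_series_inv_sqr (C := M)) => k.
rewrite mulr_ge0 ?exprn_ge0 ?moment_ge0//=.
have M0 : 0 <= M by rewrite exprn_ge0.
apply: (@le_trans _ _ (k.+1%:R ^+ N * (M / k.+1%:R ^+ (n.+1 * (3 * D))))).
  apply: ler_pM => //; rewrite ?exprn_ge0 ?moment_ge0//.
    by rewrite -natrX ler_nat bin_le_expn.
  apply: (@le_trans _ _ (moment R D n k ^+ (3 * D))).
    by rewrite ler_wiXn2l ?moment_ge0 ?moment_le1//; lia.
  rewrite /M (exprM _ n.+1) -expr_div_n.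
  by rewrite lerXn2r ?nnegrE ?moment_ge0 ?moment_le// divr_ge0 ?exprn_ge0.
rewrite mulrCA ler_wpM2l//.
(* [N] cancels the binomial bound, 2 gives the summable tail, and the surplus [3 * D - 3] is a true
   difference because [0 < D]. *)
rewrite (_ : (n.+1 * (3 * D) = N + 2 + (3 * D - 3))%N); last by rewrite /N; nia.
rewrite 2!exprD 2!invfM 2!mulrA divff ?mul1r ?expf_neq0 ?pnatr_eq0//.
rewrite ler_piMr ?invr_ge0 ?exprn_ge0//.
by rewrite invf_le1 ?exprn_gt0 ?ltr0n// -natrX ler1n expn_gt0.
Qed.

Lemma prod_weight k (v : seq R) :
  \prod_(x <- v) weight D n k x =
  (\prod_(x <- v) (x ^+ (D * n) * (1 - x ^+ D) ^+ n)) * (\prod_(x <- v) x) ^+ k.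
Proof.
rewrite -prodrXl -big_split/=; apply: eq_bigr => x _.
by rewrite /weight exprD; ring.
Qed.

(* The pole at [xi ^+ m * \prod x = 1], where the integrand divides by 0, is
   harmless: all [x] are then 1 and, as [0 < n], the numerator vanishes. *)
Lemma ccvg_rstar_integrand (m : nat) (xi : R[i]) (v : seq R) :
  normc xi = 1 -> (0 < size v)%N -> all (fun x => 0 <= x <= 1) v ->
  ccvg (fun K => \sum_(0 <= k < K)
      ('C(k + (3 * D * n).+1, (3 * D * n).+1)%:R * \prod_(x <- v) weight D n k x)%:C
        * (xi ^+ m) ^+ k)
    (rstar_integrand D n m xi v).
Proof.
move=> xi1 v0 v01; rewrite /rstar_integrand.
set F := \prod_(x <- v) (_ * _); set P := \prod_(x <- v) x.
set N := (3 * D * n).+1; rewrite addn2 -/N.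
have P0 : 0 <= P.
  by rewrite /P big_seq; apply: prodr_ge0 => x xv; case/andP: (allP v01 _ xv).
have [F0|F0] := eqVneq F 0.
  rewrite F0 mul0r (_ : (fun K => _) = (fun=> 0)); first by split; exact: cvg_cst.
  apply/funext => K; apply: big1 => k _.
  by rewrite prod_weight -/F F0 mul0r mulr0 mul0r.
(* Since [F] is nonzero, the head of [v] is not 1; the other factors are at most 1. *)
have P1 : P < 1.
  move: F0 v0 v01; rewrite /F /P.
  case: v {F P P0} => // x v F0 _ /= /andP[/andP[x0 x1] v01].
  have x1' : x < 1.
    rewrite lt_neqAle x1 andbT; apply: contraNneq F0 => ->.
    by rewrite big_cons !expr1n subrr expr0n (gtn_eqF n0) mulr0 mul0r.
  rewrite big_cons; apply: le_lt_trans x1'; rewrite ler_piMr// big_seq.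
  by apply: prodr_ile1 => y yv; exact: (allP v01).
rewrite (_ : (fun K => _) = (fun K =>
  F%:C * \sum_(0 <= k < K) 'C(k + N, N)%:R * (xi ^+ m * P%:C) ^+ k)).
  apply: ccvgMl; apply: ccvg_bin_series.
  by rewrite ComplexField.Normc.normcM normcX xi1 expr1n mul1r normc_real ger0_norm.
apply/funext => K; rewrite mulr_sumr; apply: eq_bigr => k _.
rewrite prod_weight -/F -/P !rmorphM rmorph_nat rmorphXn exprMn; ring.
Qed.

Lemma ccvg_citer_int (s m : nat) (xi : R[i]) : (3 * D - 1 <= s)%N ->
  normc xi = 1 ->
  ccvg (fun K => \sum_(0 <= k < K)
      ('C(k + (3 * D * n).+1, (3 * D * n).+1)%:R * moment R D n k ^+ s.+1)%:C
        * (xi ^+ m) ^+ k)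
    (citer_int s.+1 (rstar_integrand D n m xi)).
Proof.
move=> sD xi1; set N := (3 * D * n).+1.
have zk k : normc ((xi ^+ m) ^+ k) = 1 by rewrite !normcX xi1 !expr1n.
(* Real and imaginary parts are treated at once: [c] stands for either, and only real linearity, the
   bound by the modulus and continuity along [ccvg] are used. The coefficients [b k] are then real,
   as [iter_int_series] requires. *)
have key (c : R[i] -> R) (cM : forall (a : R) z, c (a%:C * z) = a * c z)
    (cD : forall u, c (\sum_(k <- u) k) = \sum_(k <- u) c k)
    (cn : forall z, `|c z| <= normc z)
    (cc : forall u l, ccvg u l -> c \o u @ \oo --> c l) :
  (fun K => c (\sum_(0 <= k < K)
      ('C(k + N, N)%:R * moment R D n k ^+ s.+1)%:C * (xi ^+ m) ^+ k)) @ \oo -->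
    iter_int s.+1 (fun v => c (rstar_integrand D n m xi v)).
  pose b k := 'C(k + N, N)%:R * c ((xi ^+ m) ^+ k).
  have bN k : `|b k| <= 'C(k + N, N)%:R.
    by rewrite /b normrM normr_nat ler_piMr// (le_trans (cn _))// zk.
  have sE (a : nat -> R) : (fun K => c (\sum_(0 <= k < K)
      ('C(k + N, N)%:R * a k)%:C * (xi ^+ m) ^+ k)) = series (fun k => b k * a k).
    apply/funext => K; rewrite seriesEnat/= -(big_map _ predT id) cD big_map.
    by apply: eq_bigr => k _; rewrite cM /b; ring.
  have bm : cvgn (series (fun k => `|b k| * moment R D n k ^+ s.+1)).
    apply: (series_le_cvg _ _ _ (is_cvg_bin_moment sD)) => k.
    - by rewrite mulr_ge0// exprn_ge0// moment_ge0.
    - by rewrite mulr_ge0// exprn_ge0// moment_ge0.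
    - by rewrite ler_wpM2r// exprn_ge0// moment_ge0.
  rewrite sE.
  rewrite (@eq_iter_int _ _ _ (fun v =>
    limn (series (fun k => b k * \prod_(x <- v) weight D n k x)))).
    rewrite iter_int_series.
    - apply: (@normed_cvg R R^o); move: bm.
      rewrite (_ : (fun k => `|b k| * _) = (fun k => `|b k * moment R D n k ^+ s.+1|))//.
      apply/funext => k.
      by rewrite (normrM (b k)) (ger0_norm (exprn_ge0 _ (moment_ge0 _))).
    - by move=> k; exact: integrable_exprM_1subXn.
    - by move=> k x; exact: weight_le1.
    (* At [x = 1] the binomial series diverges, but every weight vanishes there; for [x < 1] the
       weight is at most [x ^+ k]. *)
    - move=> x x01; have [->|x1] := eqVneq x 1.
        apply: (is_cvg_series_inv_sqr (C := 0)) => k.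
        by rewrite weight1 mulr0 mul0r lexx.
      have x01' : 0 <= x < 1 by case/andP: x01 => -> ?; rewrite lt_neqAle x1.
      apply: (series_le_cvg _ _ _ (@is_cvg_bin_series _ _ N x01')) => k.
      + by case/andP: (weight_itv k x01) => *; rewrite mulr_ge0.
      + by case/andP: x01 => *; rewrite mulr_ge0 ?exprn_ge0.
      + by case/andP: (weight_itv k x01) => *; rewrite ler_pM.
    - exact: bm.
  move=> v sv v01; apply/esym/cvg_lim => //; rewrite -sE.
  by apply: cc; apply: ccvg_rstar_integrand => //; rewrite sv.
split.
- apply: (key (@Re R)).
  + by move=> a [x y] /=; rewrite mul0r subr0.
  + by move=> u; elim/big_ind2 : _ => // x1 x2 y1 y2 <- <-; rewrite raddfD.
  + exact: normr_Re_le.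
  + by move=> u l [].
- apply: (key (@Im R)).
  + by move=> a [x y] /=; rewrite mul0r addr0.
  + by move=> u; elim/big_ind2 : _ => // x1 x2 y1 y2 <- <-; rewrite raddfD.
  + exact: normr_Im_le.
  + by move=> u l [].
Qed.

End Moments.

(** * Values of [Rn] at the summation points *)

(** The numerator has a zero factor at l = D(n - m) - j, nonnegative because [m < n] and
    [j <= D]. *)
Lemma Rn_eq0 (R : realType) (s D n m j : nat) : (0 < D)%N -> (j <= D)%N ->
  (m < n)%N -> Rn s D n (m%:R + j%:R / D%:R) = 0 :> R.
Proof.
move=> D0 jD mn; rewrite /Rn.
have lN : (D * n - D * m - j < (3 * D * n).+1)%N by nia.
suff -> : \prod_(0 <= l < (3 * D * n).+1)
   (m%:R + j%:R / D%:R - n%:R + l%:R / D%:R) = 0 :> R by rewrite mulr0 mul0r.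
rewrite (big_cat_nat _ (n := (D * n - D * m - j)%N)) ?leq0n//=; last exact: ltnW.
rewrite [X in _ * X]big_ltn// mulrCA; apply/eqP; rewrite mulf_eq0; apply/orP; left.
have D0' : D%:R != 0 :> R by rewrite pnatr_eq0 -lt0n.
set l := (D * n - D * m - j)%N.
have e : (D * m + j + l)%:R = (D * n)%:R :> R by congr _%:R; rewrite /l; nia.
apply/eqP; apply: (mulfI D0'); rewrite mulr0.
rewrite (_ : D%:R * _ = D%:R * m%:R + j%:R + l%:R - D%:R * n%:R); last by field.
by rewrite -!natrM -!natrD e subrr.
Qed.

(** With k+1 = qD + j the argument is n + (k+1)/D: the numerator has the factors (k+1+l)/D, the
    denominator (k+1+Dn+lD)/D to the power s+1, as in [momentE]. The leftover power of [D] is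
    [s]. *)
Lemma Rn_moment (R : realType) (s D n q j : nat) : (0 < D)%N -> (0 < j)%N ->
  (3 * D <= s.+1)%N ->
  Rn s D n ((q + n)%:R + j%:R / D%:R) =
  D%:R ^+ s * (3 * D * n).+1`!%:R / n`!%:R ^+ (3 * D) *
    ('C((q * D + j).-1 + (3 * D * n).+1, (3 * D * n).+1)%:R *
     moment R D n (q * D + j).-1 ^+ s.+1).
Proof.
move=> D0 j0 sD; set k := (q * D + j).-1.
have kE : k.+1 = (q * D + j)%N by rewrite prednK//; lia.
have D0' : D%:R != 0 :> R by rewrite pnatr_eq0 -lt0n.
have f0 : n`!%:R != 0 :> R by rewrite pnatr_eq0 -lt0n fact_gt0.
have tE : (q + n)%:R + j%:R / D%:R = n%:R + k.+1%:R / D%:R :> R.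
  by rewrite kE !natrD natrM; field.
rewrite /Rn tE; set N := (3 * D * n).+1.
rewrite (eq_bigr (fun l => (k.+1 + l)%:R * D%:R^-1)); last first.
  by move=> l _; rewrite natrD; field.
rewrite big_split/= -natr_prod prod_addn_bin natrM prodr_const_nat subn0.
rewrite (eq_bigr (fun l => ((k.+1 + D * n + l * D)%:R * D%:R^-1) ^+ s.+1)); last first.
  by move=> l _; congr (_ ^+ _); rewrite !natrD !natrM; field.
rewrite prodrXl big_split/= -natr_prod prodr_const_nat subn0 momentE.
set Q := (\prod_(0 <= l < n.+1) _)%N.
have Q0 : Q%:R != 0 :> R by rewrite pnatr_eq0 -lt0n prodn_gt0.
rewrite natrM natrX !expr_div_n !exprMn !exprVn.
have -> : n`!%:R ^+ s.+1 = n`!%:R ^+ (s.+1 - 3 * D) * n`!%:R ^+ (3 * D) :> R.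
  by rewrite -exprD subnK.
rewrite /N (exprS D%:R (3 * D * n)) (exprS D%:R n) exprMn (exprS D%:R s).
(* Powers with symbolic exponents become nonzero atoms; what remains is a rational identity in
   them. *)
have := expf_neq0 (3 * D) f0; have := expf_neq0 s.+1 Q0.
have := expf_neq0 s D0'; have := expf_neq0 (3 * D * n) D0'.
have := expf_neq0 s.+1 (expf_neq0 n D0').
set a1 := D%:R ^+ n ^+ s.+1; set a2 := D%:R ^+ (3 * D * n); set a3 := D%:R ^+ s.
set a4 := Q%:R ^+ s.+1; set a5 := n`!%:R ^+ (3 * D).
move=> *; field; do ?[apply/andP; split] => //.
Qed.

(** * Assembling the identity along multiples of [D] *)

Unset Implicit Arguments.

Theorem theorem1 (R : realType) (s D n : nat) (xi : R[i]) :
  (0 < s)%N -> (0 < D)%N -> (3 * D - 1 <= s)%N ->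
  (0 < n)%N -> ~~ odd n ->
  D.-primitive_root xi ->
  forall j : nat, (1 <= j <= D)%N ->
  (@rnj R s D n j)%:C =
    ((D%:R ^+ (s - 1) * ((3 * D * n).+1)`!%:R / (n`!%:R ^+ (3 * D)) : R)%:C)
    * \sum_(1 <= m < D.+1) xi ^- (m * j) * rstar s D n m xi.
Proof.
move=> s0 D0 sD n0 _ xiP j /andP[j0 jD].
have xi1 : normc xi = 1.
  apply/eqP; rewrite -(@pexpr_eq1 _ _ D)//; last by case: (xi) => a b; exact: sqrtr_ge0.
  by rewrite -normcX (prim_expr_order xiP) ComplexField.Normc.normc1.
set N := (3 * D * n).+1; set c : R := _ / _; set rhs := _ * _.
pose A k : R := 'C(k + N, N)%:R * moment R D n k ^+ s.+1.
(* What the filter leaves; its factor [D] raises the power [s - 1] in [c] to the power [s] of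
   [Rn_moment]. *)
pose S K := \sum_(0 <= k < K | k.+1 == j %[mod D]) D%:R * A k.
have SR : ccvg (fun K => (c * S K)%:C) rhs.
  rewrite (_ : (fun K => _) = (fun K => c%:C * \sum_(1 <= m < D.+1)
     xi ^- (m * j) * (xi ^+ m * \sum_(0 <= k < K) (A k)%:C * (xi ^+ m) ^+ k))).
    apply: ccvgMl; apply: ccvg_sum => m; apply: ccvgMl; apply: ccvgMl.
    exact: ccvg_citer_int.
  apply/funext => K; rewrite rmorphM; congr (_ * _).
  under [RHS]eq_bigr do rewrite !mulr_sumr.
  (* With the sum over [m] inside, the root of unity filter evaluates it for each [k]. *)
  rewrite exchange_big rmorph_sum big_mkcond/=; apply: eq_bigr => k _.
  rewrite (eq_bigr (fun m => (A k)%:C * (xi ^- (m * j) * (xi ^+ m * xi ^+ m ^+ k)))); last first.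
    by move=> m _; ring.
  rewrite -mulr_sumr prim_root_filter//; case: ifP => _; last by rewrite mulr0.
  by rewrite mulrC rmorphM rmorph_nat.
have SD M : S (M * D)%N = \sum_(0 <= q < M) D%:R * A (q * D + j).-1.
  elim: M => [|M IH]; first by rewrite /S mul0n !big_geq.
  rewrite big_nat_recr//= -IH /S mulSnr.
  rewrite (big_cat_nat _ (n := (M * D)%N))//=; last exact: leq_addr.
  congr (_ + _).
  (* Among the [D] indices from MD on, only MD + j - 1 meets the congruence; 1 <= j <= D puts it in
     the block. *)
  rewrite big_mkcond (bigD1_seq (M * D + j).-1) ?iota_uniq//=; last first.
    by rewrite mem_index_iota; lia.
  rewrite prednK ?addn_gt0 ?j0 ?orbT// modnMDl eqxx.
  rewrite big1_seq ?addr0// => k /andP[kj]; rewrite mem_index_iota => /andP[k1 k2].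
  case: ifP => // kD; exfalso; move/eqP: kj; apply.
  have kE : k = (M * D + (k - M * D))%N by lia.
  move: kD; rewrite {1}kE -addnS modnMDl.
  (* Both numbers lie between 1 and [D] and are distinct, so [D] cannot divide their difference; the
     order is split because subtraction is truncated. *)
  have [le|/ltnW le] := leqP j (k - M * D).+1.
    rewrite (eqn_mod_dvd _ le) => /dvdn_leq; lia.
  by rewrite eq_sym (eqn_mod_dvd _ le) => /dvdn_leq; lia.
have vS M : \sum_(1 <= m < M + n) Rn s D n (m%:R + j%:R / D%:R) = c * S (M * D)%N.
  (* The terms with [m < n] vanish; the others are indexed by q = m - n. *)
  rewrite (big_cat_nat _ (n := n))//=; last exact: leq_addl.
  rewrite big_nat big1 ?add0r; last by move=> m /andP[_ mn]; rewrite Rn_eq0.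
  rewrite -{1}[n]add0n big_addn addnK SD mulr_sumr; apply: eq_bigr => q _.
  rewrite Rn_moment//; last by lia.
  have -> : D%:R ^+ s = D%:R ^+ (s - 1) * D%:R :> R.
    by rewrite -exprSr; congr (_ ^+ _); lia.
  by rewrite /c /A -/N; ring.
(* The two sides are matched at the cutoffs [M * D], hence the passage to a subsequence. *)
have mulD : (fun M => M * D)%N @ \oo --> \oo by exact: cvg_mulnr.
have vR : ccvg (fun M => (\sum_(1 <= m < M + n) Rn s D n (m%:R + j%:R / D%:R))%:C) rhs.
  by under eq_fun do rewrite vS; exact: (ccvg_comp mulD SR).
apply: (ccvg_unique _ vR); apply: ccvg_real.
(* [rnj] is a limit, so its series must be shown to converge: the real part of [vR] gives this once
   the shift by [n] is undone. *)
have : (fun K => \sum_(1 <= m < K) Rn s D n (m%:R + j%:R / D%:R)) @ \oo --> Re rhs.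
  by rewrite -(cvg_shiftn n); exact: (proj1 vR).
by move=> H; rewrite /rnj (cvg_lim _ H)//; exact: (proj1 vR).
Qed.
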